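(* Let $n \geq 1$ be an integer, let $\lambda_0 \geq 0 > \lambda_1 \geq \cdots \geq \lambda_n$ be real numbers and let $z = a + bi$ with $a \in \mathbb{R}$ and $b > 0$. If $\lambda_0 + \sum_{j=1}^n \lambda_j - 2|z| \geq 0$, then there is an $(n+3) \times (n+3)$ normal centrosymmetric nonnegative matrix with eigenvalues $\lambda_0, \lambda_1, \ldots, \lambda_n, z, \overline{z}$.
   Context: $J$ denotes the reverse identity matrix of the appropriate size (ones on the anti-diagonal, zeros elsewhere). A square matrix $Q$ is centrosymmetric if $JQJ = Q$, nonnegative if all entries are nonnegative, and normal if $QQ^* = Q^*Q$. *)

(* Defs.v *)
From HB Require Import structures.
From mathcomp Require Import all_boot all_order all_algebra.
From mathcomp Require Import reals.
From mathcomp Require Import complex.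
Set Implicit Arguments. Unset Strict Implicit. Unset Printing Implicit Defensive.
Import Order.TTheory GRing.Theory Num.Theory.
Local Open Scope ring_scope.

Definition revid (R : pzRingType) (m : nat) : 'M[R]_m :=
  \matrix_(i < m, j < m) (if (i : nat) + j == m.-1 then 1 else 0)%R.

Definition centrosymmetric (R : pzRingType) (m : nat) (Q : 'M[R]_m) : Prop :=
  revid R m *m Q *m revid R m = Q.

Definition nonneg_mx (R : numDomainType) (m : nat) (Q : 'M[R]_m) : Prop :=
  forall i j, 0 <= Q i j.

(* For a real matrix, Q^* = Q^T *)
Definition normal_real_mx (R : numDomainType) (m : nat) (Q : 'M[R]_m) : Prop :=
  Q *m Q^T = Q^T *m Q.

(* Main.v *)
Require Import Defs.
From HB Require Import structures.
From mathcomp Require Import all_boot all_order all_algebra.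
From mathcomp Require Import ring lra zify.
From mathcomp Require Import reals.
From mathcomp Require Import complex.
Import Order.TTheory GRing.Theory Num.Theory.
Local Open Scope ring_scope.
Local Open Scope complex_scope.
Set Implicit Arguments.
Unset Strict Implicit.
Unset Printing Implicit Defensive.

(** A spectrum is realized by wrapping matrices around a centrosymmetric core [K]
with Perron pair [(al, u)]. Given a symmetric [S] with [S v = be v] and a normal [D]
with [|D| <= S] entrywise, put [A = (S + D) / 2], [B = (S - D) / 2], [X = r v u^T];
the matrix [[A, X, B J], [X^T, K, X^T J], [J B, J X, J A J]] is centrosymmetric,
nonnegative and normal, and it is similar to a block triangular matrix with diagonal
blocks [[S, X], [2 X^T, K]] and [D]. Hence its spectrum is that of [D], [S] and [K]
together, with the pair [be, al] replaced by two numbers having the same sum, which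
are prescribed through [r] (Fiedler's gluing).
The pair [a +- i b] comes from [D = [[a, b], [-b, a]]] around a core of size 0 or 1
(which settles [n = 1] and [n = 2]); wrapping with the 1x1 blocks [S = -mu2], [D = mu2]
then adds two negative eigenvalues at a time, starting from the Perron root
[l + mu1 + mu2], so that the sum in the hypothesis is preserved. *)

(** * The reverse identity matrix *)

Lemma revid_mul (R : pzRingType) m (n : nat) (A : 'M[R]_(m, n)) i j :
  (revid R m *m A) i j = A (rev_ord i) j.
Proof.
rewrite mxE (bigD1 (rev_ord i)) //= big1 ?addr0 => [|k neq_k].
  rewrite mxE /=; case: ifP => [|/eqP[]]; first by rewrite mul1r.
  by have := ltn_ord i; lia.
rewrite mxE; case: ifP => [/eqP eq_k|]; last by rewrite mul0r.
case/eqP: neq_k; apply/val_inj => /=.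
by have := ltn_ord i; lia.
Qed.

Lemma revidK (R : pzRingType) m : revid R m *m revid R m = 1%:M.
Proof.
apply/matrixP=> i j; rewrite revid_mul !mxE /= -val_eqE /=.
have := ltn_ord i; have := ltn_ord j.
by case: (_ =P m.-1) => eq_m; case: (_ =P _ :> nat) => // ?; lia.
Qed.

Lemma tr_revid (R : pzRingType) m : (revid R m)^T = revid R m.
Proof. by apply/matrixP=> i j; rewrite !mxE addrC. Qed.

(** The nesting follows the bracketing [(k + m) + k]: reversal swaps the two outer parts of size [k]
    and reverses the middle one in place. *)
Lemma revid_block (R : pzRingType) k m :
  revid R (k + m + k) =
    block_mx (block_mx 0 0 0 (revid R m)) (col_mx (revid R k) 0)
             (row_mx (revid R k) 0) 0.
Proof.
apply/matrixP=> i j.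
case: (split_ordP i) => [i1 ->|i1 ->]; case: (split_ordP j) => [j1 ->|j1 ->];
  rewrite ?(block_mxEul, block_mxEur, block_mxEdl, block_mxEdr).
- case: (split_ordP i1) => [i2 ->|i2 ->]; case: (split_ordP j1) => [j2 ->|j2 ->];
  rewrite ?(block_mxEul, block_mxEur, block_mxEdl, block_mxEdr) !mxE /=;
  have := ltn_ord i2; have := ltn_ord j2;
  by do ?case: eqP => //; lia.
- case: (split_ordP i1) => [i2 ->|i2 ->]; rewrite ?(col_mxEu, col_mxEd) !mxE /=;
  have := ltn_ord i2; have := ltn_ord j1;
  by do ?case: eqP => //; lia.
- case: (split_ordP j1) => [j2 ->|j2 ->]; rewrite ?(row_mxEl, row_mxEr) !mxE /=;
  have := ltn_ord i1; have := ltn_ord j2;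
  by do ?case: eqP => //; lia.
- rewrite !mxE /=; have := ltn_ord i1; have := ltn_ord j1.
  by case: eqP => //; lia.
Qed.

Lemma det_revid_neq0 (F : fieldType) m : \det (revid F m) != 0.
Proof.
have /eqP := det_mulmx (revid F m) (revid F m).
by rewrite revidK det1; apply: contraTneq => ->; rewrite mul0r oner_eq0.
Qed.

(** * Determinants and characteristic polynomials *)

Lemma char_poly_conj (F : fieldType) m (A B P : 'M[F]_m) :
  \det P != 0 -> A *m P = P *m B -> char_poly A = char_poly B.
Proof.
move=> P_neq0 eqAB; set Px := map_mx polyC P.
have /(congr1 determinant): char_poly_mx A *m Px = Px *m char_poly_mx B.
  rewrite /char_poly_mx mulmxBl mulmxBr mul_scalar_mx mul_mx_scalar.
  by rewrite -!map_mxM eqAB.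
rewrite !det_mulmx [RHS]mulrC; apply: mulIf.
by rewrite det_map_mx polyC_eq0.
Qed.

Lemma char_poly_ublock (R : comNzRingType) m n (A : 'M[R]_m) B (D : 'M[R]_n) :
  char_poly (block_mx A B 0 D) = char_poly A * char_poly D.
Proof.
rewrite /char_poly /char_poly_mx map_block_mx scalar_mx_block opp_block_mx.
by rewrite add_block_mx map_mx0 oppr0 addr0 det_ublock.
Qed.

Lemma char_poly11 (R : comNzRingType) (c : R) :
  char_poly (c%:M : 'M[R]_1) = 'X - c%:P.
Proof. by rewrite /char_poly det_mx11 !mxE. Qed.

(* Variant of the matrix determinant lemma that needs no inverse of [P]. *)
Lemma det_subr_mul (R : comNzRingType) m k (P : 'M[R]_m) (V : 'M_(m, k)) H De :
  P *m V = V *m De ->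
  \det (P - V *m H) * \det De = \det P * \det (De - H *m V).
Proof.
(* Two column operations on [T]: one clears [H] and shows [\det T = \det (P - V *m H)]; the other,
   of determinant [\det De], clears [V] because [P *m V = V *m De]. *)
move=> PV; set T := block_mx P V H 1%:M.
have <- : \det T = \det (P - V *m H).
  transitivity (\det (T *m block_mx 1%:M 0 (- H) 1%:M)).
    by rewrite det_mulmx det_lblock !det1 !mulr1.
  rewrite mulmx_block !mulmx0 !mulmx1 !mulmxN !add0r mul1mx subrr.
  by rewrite det_ublock det1 mulr1.
have -> : \det De = \det (block_mx 1%:M (- V) 0 De).
  by rewrite det_ublock det1 mul1r.
rewrite -det_mulmx mulmx_block !mulmx0 !mulmx1 !mulmxN !addr0 PV addNr.
by rewrite mul1mx det_lblock addrC.
Qed.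

Lemma det_block11 (R : comNzRingType) (x y z t : R) :
  \det (block_mx x%:M y%:M z%:M t%:M : 'M[R]_(1 + 1)) = x * t - y * z.
Proof.
have det2 (A : 'M[R]_(1 + 1)) : \det A =
    A (lshift 1 0) (lshift 1 0) * A (rshift 1 0) (rshift 1 0)
    - A (lshift 1 0) (rshift 1 0) * A (rshift 1 0) (lshift 1 0).
  rewrite (expand_det_row _ 0) !big_ord_recl big_ord0 addr0 /cofactor.
  rewrite !det_mx11 !mxE /bump /= expr0 expr1 mul1r mulN1r mulrN.
  by congr (A _ _ * A _ _ - A _ _ * A _ _); apply/val_inj.
rewrite det2.
by rewrite block_mxEul block_mxEur block_mxEdl block_mxEdr !mxE.
Qed.

(** The coupling blocks have rank one along eigenvectors of [S] and [M], so the determinant lemma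
    reduces their effect to a 2x2 determinant. Multiplying by the two linear factors avoids a
    division. *)
Lemma char_poly_glue (R : comNzRingType) k m (S : 'M[R]_k) (M : 'M[R]_m)
    (v : 'cV[R]_k) (u : 'cV[R]_m) (al be t w x y : R) :
  S *m v = be *: v -> M *m u = al *: u ->
  v^T *m v = t%:M -> u^T *m u = w%:M ->
  char_poly (block_mx S (x *: (v *m u^T)) (y *: (u *m v^T)) M)
    * (('X - be%:P) * ('X - al%:P)) =
  char_poly S * char_poly M
    * (('X - be%:P) * ('X - al%:P) - (x * y * t * w)%:P).
Proof.
move=> Sv Mu vv uu.
have actC n (A : 'M[R]_n) (z : 'cV[R]_n) c : A *m z = c *: z ->
    char_poly_mx A *m map_mx polyC z = map_mx polyC z *m ('X - c%:P)%:M.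
  move=> Az; rewrite /char_poly_mx mulmxBl -map_mxM Az map_mxZ mul_scalar_mx.
  by rewrite mul_mx_scalar scalerBl.
set vx := map_mx polyC v; set ux := map_mx polyC u.
(* [V] collects the two eigenvectors, and [V *m H] is exactly the off-diagonal part, so that
   [P - V *m H] is the characteristic matrix of the glued block matrix. *)
pose V := block_mx vx 0 0 ux.
pose H := block_mx 0 (x%:P *: ux^T) (y%:P *: vx^T) 0.
pose P := block_mx (char_poly_mx S) 0 0 (char_poly_mx M).
pose De : 'M_(1 + 1) := block_mx ('X - be%:P)%:M 0 0 ('X - al%:P)%:M.
have PV : P *m V = V *m De.
  by rewrite !mulmx_block !(mulmx0, mul0mx, addr0, add0r) (actC _ _ _ _ Sv)
    (actC _ _ _ _ Mu).
have := det_subr_mul H PV.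
have -> : P - V *m H = char_poly_mx (block_mx S (x *: (v *m u^T)) (y *: (u *m v^T)) M).
  rewrite /char_poly_mx map_block_mx scalar_mx_block mulmx_block.
  rewrite !(opp_block_mx, add_block_mx, mulmx0, mul0mx, addr0, add0r, oppr0).
  by rewrite !map_mxZ !map_mxM !map_trmx -!scalemxAr.
rewrite det_ublock !det_scalar1 det_ublock => ->.
congr (_ * _).
rewrite mulmx_block !(opp_block_mx, add_block_mx, mulmx0, mul0mx, addr0, add0r, oppr0).
rewrite -!scalemxAl !map_trmx -!map_mxM uu vv !map_scalar_mx !scale_scalar_mx.
by rewrite -!raddfN /= det_block11; ring.
Qed.

(** * Entrywise nonnegativity *)

Lemma revid_ge0 (R : numDomainType) m i j : 0 <= revid R m i j.
Proof. by rewrite mxE; case: ifP. Qed.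

Lemma mulmx_ge0 (R : numDomainType) m n p (A : 'M[R]_(m, n)) (B : 'M_(n, p)) :
  (forall i j, 0 <= A i j) -> (forall i j, 0 <= B i j) ->
  forall i j, 0 <= (A *m B) i j.
Proof. by move=> A0 B0 i j; rewrite mxE sumr_ge0 // => l _; apply: mulr_ge0. Qed.

Lemma row_mx_ge0 (R : numDomainType) m n p (A : 'M[R]_(m, n)) (B : 'M_(m, p)) :
  (forall i j, 0 <= A i j) -> (forall i j, 0 <= B i j) ->
  forall i j, 0 <= row_mx A B i j.
Proof. by move=> A0 B0 i j; rewrite mxE; case: split. Qed.

Lemma col_mx_ge0 (R : numDomainType) m n p (A : 'M[R]_(m, n)) (B : 'M_(p, n)) :
  (forall i j, 0 <= A i j) -> (forall i j, 0 <= B i j) ->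
  forall i j, 0 <= col_mx A B i j.
Proof. by move=> A0 B0 i j; rewrite mxE; case: split. Qed.

Lemma eq_from_sum_diff (R : realFieldType) m n (p q p' q' : 'M[R]_(m, n)) :
  p + q = p' + q' -> p - q = p' - q' -> p = p' /\ q = q'.
Proof.
move=> /matrixP eD /matrixP eB.
by split; apply/matrixP => i j; have:= eD i j; have:= eB i j; rewrite !mxE; lra.
Qed.

(** * Algebra of centrosymmetric block matrices *)

Section CentroBlock.
Variables (R : realFieldType) (k m : nat).
Implicit Types (A B : 'M[R]_k) (X : 'M[R]_(k, m)) (Y : 'M[R]_(m, k)) (K : 'M[R]_m).
Local Notation J := (revid R).

(** The outer block columns and rows are mirrored by [J k] only. No reversal acts on the middle
    indices, which is adequate when [X] and [Y] are invariant under [J m]. *)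
Definition centro_mx A B X Y K : 'M[R]_(k + m + k) :=
  block_mx (block_mx A X Y K) (col_mx (B *m J k) (Y *m J k))
           (row_mx (J k *m B) (J k *m X)) (J k *m A *m J k).

Definition centro_col (x : 'cV[R]_k) (y : 'cV[R]_m) : 'cV[R]_(k + m + k) :=
  col_mx (col_mx x y) (J k *m x).

Let JJ n (Z : 'M[R]_(k, n)) : J k *m (J k *m Z) = Z.
Proof. by rewrite mulmxA revidK mul1mx. Qed.

Let JJr n (Z : 'M[R]_(n, k)) : Z *m J k *m J k = Z.
Proof. by rewrite -mulmxA revidK mulmx1. Qed.

Lemma centro_mx_tr A B X Y K : (centro_mx A B X Y K)^T = centro_mx A^T B^T Y^T X^T K^T.
Proof.
rewrite /centro_mx !tr_block_mx tr_col_mx tr_row_mx !trmx_mul tr_revid.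
by rewrite !mulmxA.
Qed.

Let addr3 (V : zmodType) (x y z : V) : x + y + z = z + y + x.
Proof. by rewrite addrC [x + y]addrC addrA. Qed.

(** Adjacent copies of [J k] cancel, so the shape is stable under products; together with
    [centro_mx_tr] this turns normality into identities between the five blocks. *)
Lemma centro_mx_mul A B X Y K A' B' X' Y' K' :
  centro_mx A B X Y K *m centro_mx A' B' X' Y' K' =
  centro_mx (A *m A' + X *m Y' + B *m B') (A *m B' + X *m Y' + B *m A')
       (A *m X' + X *m K' + B *m X') (Y *m A' + K *m Y' + Y *m B')
       (Y *m X' + K *m K' + Y *m X').
Proof.
rewrite /centro_mx !(mulmx_block, mul_block_col, mul_row_block, mul_col_row,
  add_block_mx, mul_row_col, mul_col_mx, mul_mx_row, add_col_mx, add_row_mx).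
rewrite !(mulmxDl, mulmxDr) -!mulmxA !JJ !mulmxA.
by congr block_mx; [congr col_mx | congr row_mx | ]; apply: addr3.
Qed.

Lemma centro_mx_mulcol A B X Y K x y :
  centro_mx A B X Y K *m centro_col x y =
  centro_col ((A + B) *m x + X *m y) ((Y + Y) *m x + K *m y).
Proof.
rewrite /centro_mx /centro_col !(mul_block_col, mul_row_col, mul_col_mx, add_col_mx).
rewrite !(mulmxDl, mulmxDr) -!mulmxA !JJ.
by congr (col_mx (col_mx _ _) _); rewrite addrAC // (addrC (_ *m (B *m x))).
Qed.

Lemma centro_mxP A B X Y K :
  J m *m K *m J m = K -> X *m J m = X -> J m *m Y = Y ->
  centrosymmetric (centro_mx A B X Y K).
Proof.
move=> JKJ XJ JY; rewrite /centrosymmetric revid_block /centro_mx.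
rewrite !(mulmx_block, mul_block_col, mul_row_block, mul_col_row,
  add_block_mx, mul_row_col, mul_col_mx, mul_mx_row, add_col_mx, add_row_mx).
rewrite -!block_mxEh !(mulmx0, mul0mx, addr0, add0r, add_block_mx, mulmx_block,
  mul_block_col, add_col_mx, col_mx0).
by rewrite JKJ JY -!mulmxA !JJ revidK !mulmx1 XJ JY.
Qed.

Lemma revid_centro_col x y : J m *m y = y ->
  J (k + m + k) *m centro_col x y = centro_col x y.
Proof.
move=> Jy; rewrite /centro_col revid_block.
rewrite !(mul_block_col, mul_row_col, mul_col_mx, add_col_mx).
by rewrite !(mul0mx, addr0, add0r) Jy JJ.
Qed.

Lemma centro_mx_ge0 A B X Y K :
  (forall i j, 0 <= A i j) -> (forall i j, 0 <= B i j) ->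
  (forall i j, 0 <= X i j) -> (forall i j, 0 <= Y i j) ->
  (forall i j, 0 <= K i j) -> nonneg_mx (centro_mx A B X Y K).
Proof.
move=> A0 B0 X0 Y0 K0; have J0 := @revid_ge0 R k.
rewrite /nonneg_mx /centro_mx !block_mxEv.
by do ?[exact | apply: mulmx_ge0 | apply: row_mx_ge0 | apply: col_mx_ge0].
Qed.

Lemma centro_col_ge0 (x : 'cV[R]_k) (y : 'cV[R]_m) :
  (forall i j, 0 <= x i j) -> (forall i j, 0 <= y i j) ->
  forall i j, 0 <= centro_col x y i j.
Proof.
move=> x0 y0; have J0 := @revid_ge0 R k.
by do ?[exact | apply: mulmx_ge0 | apply: col_mx_ge0].
Qed.

Lemma centro_col_norm x y :
  (centro_col x y)^T *m centro_col x y = x^T *m x + y^T *m y + x^T *m x.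
Proof.
rewrite /centro_col !tr_col_mx !mul_row_col trmx_mul tr_revid -!mulmxA.
by rewrite !JJ.
Qed.

(** The vectors [(x, y, J x)] form an invariant subspace, on which the action is the first factor;
    on the quotient it is [A - B]. The conjugating matrix is a basis adapted to this subspace. *)
Lemma char_poly_centro_mx A B X Y K :
  char_poly (centro_mx A B X Y K) =
  char_poly (block_mx (A + B) X (Y + Y) K) * char_poly (A - B).
Proof.
rewrite -(char_poly_ublock _ (col_mx B Y)).
apply: (@char_poly_conj _ _ _ _ (block_mx 1%:M 0 (row_mx (J k) 0) (J k))).
  by rewrite det_lblock det1 mul1r det_revid_neq0.
rewrite /centro_mx.
rewrite !(mulmx_block, mul_block_col, mul_row_block, mul_col_row,
  add_block_mx, mul_row_col, mul_col_mx, mul_mx_row, add_col_mx, add_row_mx).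
rewrite !(mulmx0, mul0mx, addr0, add0r, mul1mx, mulmx1).
rewrite !JJr !add_row_mx !addr0 -block_mxEv -!mulmxDr [B + (A - B)]addrC subrK.
by rewrite [B + A]addrC.
Qed.

End CentroBlock.

(* The Perron vector is not normalized, so that [w = 0] covers the empty matrix. *)
Record perron_block (R : realFieldType) m (Q : 'M[R]_m) (u : 'cV[R]_m) (l w : R) :
    Prop := PerronBlock {
  perron_normal : normal_real_mx Q;
  perron_centro : centrosymmetric Q;
  perron_ge0 : nonneg_mx Q;
  perron_vec_ge0 : forall i j, 0 <= u i j;
  perron_vec_rev : revid R m *m u = u;
  perron_right : Q *m u = l *: u;
  perron_left : Q^T *m u = l *: u;
  perron_norm : u^T *m u = w%:M }.

(** * Wrapping a symmetric and a normal block around a core *)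

Section Glue.
Variables (R : realFieldType) (k m : nat) (S D : 'M[R]_k) (v : 'cV[R]_k) (be t : R).
Variables (K : 'M[R]_m) (u : 'cV[R]_m) (al w l r : R).
Hypotheses (symS : S^T = S) (normD : normal_real_mx D).
Hypothesis absD : forall i j, `|D i j| <= S i j.
Hypotheses (v_ge0 : forall i j, 0 <= v i j) (Sv : S *m v = be *: v)
  (vv : v^T *m v = t%:M) (t_ge0 : 0 <= t).
Hypothesis hK : perron_block K u al w.
Hypotheses (r_ge0 : 0 <= r) (le_al : al <= l).
(** Says that [l] is an eigenvalue of the 2x2 matrix [[[be, r w], [2 r t, al]]], which is the action
    on the symmetric vectors built from [v] and [u]. By the trace, the other eigenvalue is
    [al + be - l]. *)
Hypothesis r_eq : 2 * r ^+ 2 * t * w = (l - al) * (l - be).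

Let A : 'M[R]_k := 2^-1 *: (S + D).
Let B : 'M[R]_k := 2^-1 *: (S - D).
Let X : 'M[R]_(k, m) := r *: (v *m u^T).

Definition glue := centro_mx A B X X^T K.
Definition glue_vec := centro_col ((l - al) *: v) ((2 * r * t) *: u).

Let AB : A + B = S.
Proof. by apply/matrixP=> i j; rewrite !mxE; field. Qed.

Let AsubB : A - B = D.
Proof. by apply/matrixP=> i j; rewrite !mxE; field. Qed.

Lemma char_poly_glue_mx :
  char_poly glue * (('X - be%:P) * ('X - al%:P)) =
  char_poly D * char_poly S * char_poly K
    * (('X - l%:P) * ('X - (al + be - l)%:P)).
Proof.
rewrite char_poly_centro_mx AB AsubB.
have -> : X^T + X^T = (2 * r) *: (u *m v^T).
  by rewrite /X !linearZ /= trmx_mul trmxK -scalerDl; congr (_ *: _); ring.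
rewrite mulrAC (char_poly_glue _ _ Sv (perron_right hK) vv (perron_norm hK)).
have -> : r * (2 * r) * t * w = (l - al) * (l - be) by rewrite -r_eq; ring.
ring.
Qed.

Lemma glue_perron :
  perron_block glue glue_vec l (2 * (l - al) ^+ 2 * t + (2 * r * t) ^+ 2 * w).
Proof.
case: hK => nK cK K0 u0 Ju Ku KTu uu.
have XJ : X *m revid R m = X.
  by rewrite /X -scalemxAl -mulmxA -{1}[revid R m]tr_revid -trmx_mul Ju.
have X0 i j : 0 <= X i j.
  rewrite !mxE big_ord1 !mxE; apply: mulr_ge0 => //; exact: mulr_ge0.
have XK : X *m K = al *: X.
  rewrite /X -scalemxAl -mulmxA -[K]trmxK -trmx_mul KTu linearZ /= -scalemxAr.
  by rewrite !scalerA mulrC.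
have XKT : X *m K^T = al *: X.
  by rewrite /X -scalemxAl -mulmxA -trmx_mul Ku linearZ /= -scalemxAr !scalerA mulrC.
have AB_T : A^T + B^T = S by rewrite -raddfD AB.
(* The sum of the two identities reads [S *m S = S *m S], by symmetry of [S], and their difference
   is the normality of [D]. *)
have [nP nQ] : A *m A^T + B *m B^T = A^T *m A + B^T *m B /\
    A *m B^T + B *m A^T = A^T *m B + B^T *m A.
  have mD (P Q P' Q' : 'M[R]_k) :
      P *m P' + Q *m Q' + (P *m Q' + Q *m P') = (P + Q) *m (P' + Q').
    by rewrite mulmxDl !mulmxDr addrACA (addrC (Q *m Q')).
  have mB (P Q P' Q' : 'M[R]_k) :
      P *m P' + Q *m Q' - (P *m Q' + Q *m P') = (P - Q) *m (P' - Q').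
    by rewrite -mD !mulmxN !mulNmx opprK opprD.
  have AB_tr : A^T - B^T = D^T by rewrite -raddfB AsubB.
  by apply: eq_from_sum_diff; rewrite ?mD ?mB ?AB ?AB_T // AsubB AB_tr.
have Xu : X *m u = (r * w) *: v.
  by rewrite /X -scalemxAl -mulmxA uu mul_mx_scalar scalerA.
have XTv : X^T *m v = (r * t) *: u.
  by rewrite /X linearZ /= trmx_mul trmxK -scalemxAl -mulmxA vv mul_mx_scalar scalerA.
(* Only the sum of the outer blocks matters here, so one statement serves both [glue] and its
   transpose. *)
have act A' B' (K' : 'M[R]_m) : A' + B' = S -> K' *m u = al *: u ->
    centro_mx A' B' X X^T K' *m glue_vec = l *: glue_vec.
  move=> A'B' K'u; rewrite centro_mx_mulcol A'B' -!scalemxAr Sv Xu mulmxDl XTv K'u.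
  rewrite -scalerDl !scalerA -!scalerDl /glue_vec /centro_col !scale_col_mx.
  rewrite -!scalemxAr !scalerA.
  have -> : (l - al) * be + 2 * r * t * (r * w) = l * (l - al).
    by transitivity ((l - al) * be + 2 * r ^+ 2 * t * w); [|rewrite r_eq]; ring.
  by congr (col_mx (col_mx _ (_ *: _)) _); ring.
split.
- rewrite /normal_real_mx centro_mx_tr trmxK !centro_mx_mul.
  congr centro_mx.
  + by rewrite addrAC nP addrAC.
  + by rewrite addrAC nQ addrAC.
  + by rewrite addrAC -mulmxDl AB [RHS]addrAC -mulmxDl AB_T XK XKT.
  + rewrite addrAC -mulmxDr AB_T [RHS]addrAC -mulmxDr AB; congr (_ + _).
    by rewrite -[K in LHS]trmxK -!trmx_mul XK XKT.
  + by rewrite nK.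
- apply: centro_mxP => //.
  by rewrite -[RHS](congr1 trmx XJ) trmx_mul tr_revid.
- apply: centro_mx_ge0 => // i j; last by rewrite mxE.
  + by have := absD i j; rewrite ler_norml !mxE => /andP[? ?]; lra.
  + by have := absD i j; rewrite ler_norml !mxE => /andP[? ?]; lra.
- by apply: centro_col_ge0 => i j; rewrite mxE !mulr_ge0 // subr_ge0.
- by rewrite revid_centro_col // -scalemxAr Ju.
- exact: act.
- by rewrite centro_mx_tr trmxK; apply: act.
- rewrite centro_col_norm !linearZ /= -!scalemxAl vv uu.
  rewrite !scale_scalar_mx -!raddfD /=; congr scalar_mx; ring.
Qed.
End Glue.

(** * Building the spectrum *)

(** The Perron root is kept apart from [f] because the next wrapping replaces it; [0 < w] allows the
    gluing constant to be solved for. *)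
Definition realizes (R : realFieldType) N (l : R) (f : {poly R}) : Prop :=
  exists Q : 'M[R]_N, exists u w,
    [/\ perron_block Q u l w, 0 < w & char_poly Q = ('X - l%:P) * f].

Lemma char_poly_block11 (R : comNzRingType) (x y z t : R) :
  char_poly (block_mx x%:M y%:M z%:M t%:M : 'M[R]_(1 + 1)) =
  ('X - x%:P) * ('X - t%:P) - (y * z)%:P.
Proof.
rewrite /char_poly /char_poly_mx map_block_mx scalar_mx_block opp_block_mx.
rewrite add_block_mx !add0r !map_scalar_mx -!raddfN -!raddfD det_block11 /=.
by ring.
Qed.

Lemma perron_block0 (R : realFieldType) c :
  perron_block (0 : 'M[R]_c) (const_mx 1) 0 c%:R.
Proof.
split; rewrite /normal_real_mx /centrosymmetric ?mulmx0 ?mul0mx ?trmx0 ?mul0mx ?scale0r //.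
- by move=> i j; rewrite mxE.
- by move=> i j; rewrite mxE.
- by apply/matrixP=> i j; rewrite revid_mul !mxE.
apply/matrixP=> i j; rewrite !ord1 !mxE.
by under eq_bigr do rewrite !mxE mulr1; rewrite sumr_const card_ord.
Qed.

Lemma char_poly0 (R : comNzRingType) c : char_poly (0 : 'M[R]_c) = 'X^c.
Proof. by rewrite /char_poly /char_poly_mx map_mx0 subr0 det_scalar. Qed.

Section Realize.
Variable R : rcfType.
Implicit Types (l a b be mu : R).

(** Here [S = [[p, q], [q, p]]] has eigenvalues [p + q = be], along [(1, 1)], and [p - q = mu]. The
    core is the zero matrix of size [c]; for [c = 0] nothing can be glued, which forces [l = be] or
    [l = 0] in [r_eq]. *)
Lemma realize_base c l be mu a b :
  0 < l -> be <= l -> (c == 0%N) ==> (l == be) ->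
  `|a| <= (be + mu) / 2 -> `|b| <= (be - mu) / 2 ->
  exists Q : 'M[R]_(1 + 1 + c + (1 + 1)), exists u w,
    [/\ perron_block Q u l w, 0 < w &
        char_poly Q * (('X - be%:P) * 'X) =
          (('X - a%:P) ^+ 2 + (b ^+ 2)%:P) * (('X - be%:P) * ('X - mu%:P)) * 'X^c
           * (('X - l%:P) * ('X - (be - l)%:P))].
Proof.
move=> l_gt0 le_be c0 le_a le_b; set p := _ / 2 in le_a; set q := _ / 2 in le_b.
pose S : 'M[R]_(1 + 1) := block_mx p%:M q%:M q%:M p%:M.
pose D : 'M[R]_(1 + 1) := block_mx a%:M b%:M (- b)%:M a%:M.
pose v : 'cV[R]_(1 + 1) := col_mx 1%:M 1%:M.
(* For [c = 0] the divisor vanishes and [r = 0]. *)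
pose r := Num.sqrt (l * (l - be) / (4 * c%:R)).
have symS : S^T = S by rewrite tr_block_mx !tr_scalar_mx.
have normD : normal_real_mx D.
  rewrite /normal_real_mx tr_block_mx !tr_scalar_mx !mulmx_block.
  by rewrite -!scalar_mxM -!raddfD /=; congr block_mx; congr scalar_mx; ring.
have absD i j : `|D i j| <= S i j.
  rewrite /D /S !block_mxEv.
  case: (split_ordP i) => i' ->; rewrite ?(col_mxEu, col_mxEd);
  case: (split_ordP j) => j' ->; rewrite ?(row_mxEl, row_mxEr) !ord1 !mxE //=.
  by rewrite mulr1n normrN.
have v_ge0 i j : 0 <= v i j.
  by apply: col_mx_ge0 => ? ?; rewrite mxE; case: eqP.
have Sv : S *m v = be *: v.
  rewrite mul_block_col !mulmx1 scale_col_mx !scale_scalar_mx -!raddfD /= mulr1.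
  by congr (col_mx (scalar_mx _) (scalar_mx _)); rewrite /p /q; field.
have vv : v^T *m v = 2%:M.
  by rewrite tr_col_mx mul_row_col !tr_scalar_mx mulmx1 -raddfD.
have r_ge0 : 0 <= r by apply: sqrtr_ge0.
have r_eq : 2 * r ^+ 2 * 2 * c%:R = (l - 0) * (l - be).
  rewrite sqr_sqrtr; last first.
    by rewrite !mulr_ge0 ?invr_ge0 ?mulr_ge0 ?ler0n ?subr_ge0 // ltW.
  have [c_eq0 | c_neq0] := eqVneq c 0%N.
    by move: c0; rewrite c_eq0 /= => /eqP ->; ring.
  by field; rewrite pnatr_eq0.
have hP := glue_perron symS normD absD v_ge0 Sv vv (ler0n _ 2)
  (perron_block0 R c) r_ge0 (ltW l_gt0) r_eq.
have hC := char_poly_glue_mx D Sv vv (perron_block0 R c) r_eq.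
exists (glue S D v 0 (const_mx 1) r); do 2!eexists; split; first exact: hP.
  by rewrite subr0 ltr_wpDr ?mulr_ge0 ?sqr_ge0 ?ler0n // !mulr_gt0.
move: hC; rewrite polyC0 subr0 add0r char_poly0 !char_poly_block11 => ->.
have -> : ('X - p%:P) * ('X - p%:P) - (q * q)%:P = ('X - be%:P) * ('X - mu%:P) :> {poly R}.
  have -> : be = p + q by rewrite /p /q; field.
  have -> : mu = p - q by rewrite /p /q; field.
  by ring.
by ring.
Qed.

Lemma realize_step N l mu1 mu2 f :
  mu1 < 0 -> mu2 < 0 -> 0 <= l + mu1 + mu2 -> realizes N (l + mu1 + mu2) f ->
  realizes (1 + N + 1) l (('X - mu1%:P) * ('X - mu2%:P) * f).
Proof.
move=> mu1_lt0 mu2_lt0 al_ge0 [K [u [w [hK w_gt0 charK]]]].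
set al := l + mu1 + mu2 in al_ge0 hK charK.
(* Solves [r_eq] with [t = 1] and [be = - mu2]. The radicand is nonnegative since
   [l - al = - mu1 - mu2] and [l + mu2 >= - mu1]. *)
pose r := Num.sqrt ((l - al) * (l + mu2) / (2 * w)).
have al_lt : 0 < l - al by rewrite /al; lra.
have be_le : 0 <= l + mu2 by rewrite /al in al_ge0; lra.
have symS : ((- mu2)%:M : 'M[R]_1)^T = (- mu2)%:M by rewrite tr_scalar_mx.
have normD : normal_real_mx (mu2%:M : 'M[R]_1) by rewrite /normal_real_mx tr_scalar_mx.
have absD i j : `|(mu2%:M : 'M[R]_1) i j| <= ((- mu2)%:M : 'M[R]_1) i j.
  by rewrite !ord1 !mxE /= !mulr1n ltr0_norm.
have v_ge0 i j : 0 <= (1%:M : 'cV[R]_1) i j by rewrite mxE; case: eqP.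
have Sv : (- mu2)%:M *m (1%:M : 'cV[R]_1) = (- mu2) *: 1%:M.
  by rewrite mul_scalar_mx.
have vv : (1%:M : 'cV[R]_1)^T *m 1%:M = 1%:M by rewrite trmx1 mulmx1.
have r_ge0 : 0 <= r by apply: sqrtr_ge0.
have r_eq : 2 * r ^+ 2 * 1 * w = (l - al) * (l - - mu2).
  rewrite sqr_sqrtr; first by field; rewrite gt_eqF.
  by rewrite !mulr_ge0 ?invr_ge0 ?mulr_ge0 // ltW.
have al_le : al <= l by rewrite -subr_ge0 ltW.
have hP := glue_perron symS normD absD v_ge0 Sv vv ler01 hK r_ge0 al_le r_eq.
have hC := char_poly_glue_mx mu2%:M Sv vv hK r_eq.
do 3!eexists; split; first exact: hP.
  by rewrite ltr_wpDr ?mulr_ge0 ?sqr_ge0 ?ler0n // ?ltW // !mulr_gt0 // exprn_gt0.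
apply: (@mulIf _ (('X - (- mu2)%:P) * ('X - al%:P))).
  by rewrite mulf_neq0 ?polyXsubC_eq0.
rewrite hC charK !char_poly11.
have -> : al + - mu2 - l = mu1 by rewrite /al; ring.
by ring.
Qed.

Lemma realize_seq (s : seq R) l a b :
  s != [::] -> all (fun x => x < 0) s -> b != 0 ->
  0 <= l + \sum_(x <- s) x - 2 * Num.sqrt (a ^+ 2 + b ^+ 2) ->
  realizes (size s + 3) l
    ((('X - a%:P) ^+ 2 + (b ^+ 2)%:P) * \prod_(x <- s) ('X - x%:P)).
Proof.
move=> s_neq0 s_lt0 b_neq0; set z := Num.sqrt _.
have le_az : `|a| <= z by rewrite -sqrtr_sqr ler_wsqrtr // lerDl sqr_ge0.
have le_bz : `|b| <= z by rewrite -sqrtr_sqr ler_wsqrtr // lerDr sqr_ge0.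
have z_gt0 : 0 < z by rewrite (lt_le_trans _ le_bz) // normr_gt0.
(* Induction on a bound for the length, as each step removes two entries; [l] varies because the
   Perron root of the core is [l + x + y]. *)
have [n] := ubnP (size s).
elim: n => // n IHn in s l s_neq0 s_lt0 *.
case: s s_neq0 s_lt0 => // x [|y [|y' s]] _ /=.
- rewrite andbT => x_lt0 _; rewrite !big_seq1 => le_sum.
  (* Empty core: [S] has eigenvalues [l] and [x], and [z <= (l + x) / 2 <= (l - x) / 2] bounds both
     [a] and [b]. *)
  have [|||||Q [u [w [hQ w_gt0 charQ]]]] := @realize_base 0 l l x a b => //=.
  + by lra.
  + by apply: le_trans le_az _; lra.
  + by apply: le_trans le_bz _; lra.
  exists Q, u, w; split => //.
  apply: (@mulIf _ (('X - l%:P) * 'X)).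
    by rewrite mulf_neq0 ?polyXsubC_eq0 ?polyX_eq0.
  by rewrite charQ subrr polyC0 expr0; ring.
- case/and3P=> x_lt0 y_lt0 _ _; rewrite !big_cons !big_nil => le_sum.
  (* Core [0] of size 1: gluing trades the eigenvalues [l + x] and [0] for [l] and [x], while [y]
     remains from [S]. *)
  have [|||||Q [u [w [hQ w_gt0 charQ]]]] := @realize_base 1 l (l + x) y a b => //=.
  + by lra.
  + by lra.
  + by apply: le_trans le_az _; lra.
  + by apply: le_trans le_bz _; lra.
  exists Q, u, w; split => //.
  apply: (@mulIf _ (('X - (l + x)%:P) * 'X)).
    by rewrite mulf_neq0 ?polyXsubC_eq0 ?polyX_eq0.
  rewrite charQ (_ : l + x - l = x); last by ring.
  by rewrite expr1; ring.
case/and3P=> x_lt0 y_lt0 s_lt0; rewrite 2!big_cons => size_s le_sum.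
(* Gives [0 <= l + x + y], the nonnegativity of the Perron root of the smaller matrix. *)
have sum_le0 : \sum_(x <- y' :: s) x <= 0.
  rewrite big_seq; apply: sumr_le0 => t t_s; apply: ltW.
  by have /allP := s_lt0 : all (fun x => x < 0) (y' :: s); apply.
have -> : ((size s).+3 + 3 = 1 + ((size s).+1 + 3) + 1)%N by lia.
set P := _ + _; have -> : P * \prod_(t <- [:: x, y, y' & s]) ('X - t%:P) =
    ('X - x%:P) * ('X - y%:P) * (P * \prod_(t <- y' :: s) ('X - t%:P)).
  by rewrite 2!big_cons; ring.
apply: realize_step => //; first by lra.
apply: (IHn (y' :: s)) => //=; [by lia | by lra].
Qed.
End Realize.

Theorem theorem3p7 (R : realType) (n : nat) (lam : nat -> R) (a b : R) :
  (1 <= n)%N ->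
  0 <= lam 0%N -> lam 1%N < 0 ->
  (forall i j : nat, (1 <= i)%N -> (i <= j)%N -> (j <= n)%N -> lam j <= lam i) ->
  0 < b ->
  0 <= lam 0%N + \sum_(1 <= j < n.+1) lam j - 2 * Num.sqrt (a ^+ 2 + b ^+ 2) ->
  exists Q : 'M[R]_(n + 3),
    [/\ normal_real_mx Q, centrosymmetric Q, nonneg_mx Q &
      map_poly (fun x : R => x%:C) (char_poly Q) =
        (\prod_(0 <= j < n.+1) ('X - ((lam j)%:C)%:P))
        * ('X - (a +i* b)%:P) * ('X - (a +i* (- b))%:P)].
Proof.
move=> n_gt0 _ lam1_lt0 lam_le b_gt0 le_sum.
pose s := [seq lam j | j <- index_iota 1 n.+1].
have size_s : size s = n by rewrite size_map size_iota subn1.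
have [Q [u [w [[nQ cQ Q0 _ _ _ _ _] _ charQ]]]] : realizes (n + 3) (lam 0%N)
    ((('X - a%:P) ^+ 2 + (b ^+ 2)%:P) * \prod_(x <- s) ('X - x%:P)).
  rewrite -[in (n + 3)%N]size_s; apply: realize_seq.
  - by rewrite -size_eq0 size_s -lt0n.
  - apply/allP=> x /mapP[j]; rewrite mem_index_iota => /andP[j_gt0 j_le] ->.
    by apply: le_lt_trans lam1_lt0; apply: lam_le.
  - by rewrite gt_eqF.
  - by rewrite big_map.
exists Q; split=> //.
rewrite charQ big_map -/(real_complex R).
rewrite 2!rmorphM rmorph_prod /= !map_polyXsubC.
rewrite [in RHS]big_ltn //; under eq_bigr do rewrite map_polyXsubC.
rewrite rmorphD !rmorphXn /= map_polyXsubC map_polyC /=.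
set P := \prod_(_ <= _ < _) _.
(* Writing both roots through ['i] lets [ring] factor [('X - a) ^+ 2 + b ^+ 2], once [b ^+ 2] is
   rewritten as [- ('i * b) ^+ 2]. *)
have -> : a +i* b = a%:C + 'i%C * b%:C by simpc.
have -> : a +i* - b = a%:C - 'i%C * b%:C by simpc.
have -> : (b%:C)%:P ^+ 2 = - ('i%C * b%:C)%:P ^+ 2 :> {poly R[i]}.
  by rewrite -!polyC_exp exprMn sqr_i mulN1r polyCN opprK.
by ring.
Qed.
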